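(* Let $r>\frac12$ and $s>\max(1,2r-1)$, and let $y(s,r)=s+\mathop{K}_{n=1}^{\infty}\left(\dfrac{(2n-1)^2r^2-(r-1)^2}{2s}\right)$. Then $$\frac{\partial^2}{\partial s^2}(\ln y)(s,r)=-\frac{1}{2r^2}\int_0^{\infty}\frac{x\left(e^{-\frac{1-r+s}{r}x}+e^{-\frac{r-1+s}{r}x}\right)}{\cosh x}\,dx=-h_1(s,r)-h_2(s,r),$$ where $$h_1(s,r)=\dfrac{1}{2(1-2r+s)(1+s)+2\,\mathrm{TK}_{n=1}^{\infty}\left(\frac{4n^2r^2}{1}+\frac{4n^2r^2}{(1-2r+s)(1+s)}\right)},$$ $$h_2(s,r)=\dfrac{1}{2(2r-1+s)(s-1)+2\,\mathrm{TK}_{n=1}^{\infty}\left(\frac{4n^2r^2}{1}+\frac{4n^2r^2}{(2r-1+s)(s-1)}\right)}.$$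
   Context: $\mathop{K}_{n=1}^{\infty}\left(\frac{a_n}{b_n}\right)$ denotes the continued fraction $\cfrac{a_1}{b_1+\cfrac{a_2}{b_2+\cdots}}$ (limit of convergents). For a quantity $c$ and constant $A$, the notation $c+\mathrm{TK}_{n=1}^\infty\left(\frac{An^2}{1}+\frac{An^2}{c}\right)$ denotes the continued fraction $$c+\cfrac{A\cdot1^2}{1+\cfrac{A\cdot1^2}{c+\cfrac{A\cdot2^2}{1+\cfrac{A\cdot 2^2}{c+\cdots}}}},$$ i.e. partial numerators $A1^2,A1^2,A2^2,A2^2,A3^2,\dots$ and partial denominators alternating $1,c,1,c,\dots$; $2c+2\,\mathrm{TK}(\cdots)$ means twice this quantity. *)

(* Defs.v *)
From Stdlib Require Import Reals Lra.
From Coquelicot Require Import Coquelicot.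
Open Scope R_scope.

Fixpoint cf_tail (a b : nat -> R) (k n : nat) : R :=
  match n with
  | O => 0
  | S n' => a k / (b k + cf_tail a b (S k) n')
  end.

Definition cf_conv (a b : nat -> R) (N : nat) : R := cf_tail a b 1 N.

Definition cf_converges (a b : nat -> R) : Prop := ex_finite_lim_seq (cf_conv a b).

Definition cf_value (a b : nat -> R) : R := real (Lim_seq (cf_conv a b)).

(* TK_{n>=1}(A n^2/1 + A n^2/c) as a K-fraction: partial numerators
   A1^2, A1^2, A2^2, A2^2, ... and partial denominators 1, c, 1, c, ... *)
Definition tk_num (A : R) (k : nat) : R := A * (INR ((k + 1) / 2)) ^ 2.
Definition tk_den (c : R) (k : nat) : R := if Nat.odd k then 1 else c.
Definition TK (A c : R) : R := cf_value (tk_num A) (tk_den c).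

Definition y_num (r : R) (n : nat) : R := (2 * INR n - 1) ^ 2 * r ^ 2 - (r - 1) ^ 2.
Definition y_den (s : R) (n : nat) : R := 2 * s.
Definition y_fun (s r : R) : R := s + cf_value (y_num r) (y_den s).

Definition cfc1 (s r : R) : R := (1 - 2 * r + s) * (1 + s).
Definition cfc2 (s r : R) : R := (2 * r - 1 + s) * (s - 1).

Definition h1 (s r : R) : R := 1 / (2 * cfc1 s r + 2 * TK (4 * r ^ 2) (cfc1 s r)).
Definition h2 (s r : R) : R := 1 / (2 * cfc2 s r + 2 * TK (4 * r ^ 2) (cfc2 s r)).

Definition integrand (s r x : R) : R :=
  x * (exp (- ((1 - r + s) / r) * x) + exp (- ((r - 1 + s) / r) * x)) / cosh x.

(* Main.v *)
Require Import Defs.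
From Stdlib Require Import Reals Lra Lia Psatz.
From Coquelicot Require Import Coquelicot.
Open Scope R_scope.

(* The three quantities are determined by first-order functional equations in s.
   Brouncker's fraction satisfies y(s) y(s+2r) = (s+2r-1)(s+1); taking logarithms
   and iterating writes ln y(s) as the limit of
   sum_{j<2n} (-1)^j [ln(s+2rj+2r-1) + ln(s+2rj+1)] + ln(s+4rn),
   which may be differentiated twice term by term.
   With X(a) = c + TK(4r^2, c), c = a^2 - r^2, one has
   1/X(a) + 1/X(a+2r) = 2/(a+r)^2, and S(a) = int_0^oo x e^(-ax)/cosh x dx satisfies
   S(a) + S(a+2) = 2/(a+1)^2.  Nonnegative solutions of the last two equations are
   unique, so both sides equal the same alternating series, which is also the one
   obtained for (ln y)''.
   The equations for the fractions hold for the convergents up to an explicit error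
   whose sign alternates, so they become exact in the limit. *)

(** * Convergents of continued fractions with positive elements *)

(* The pair (u_n, u_{n-1}), with u_0 = u and u_{-1} = v, where u_n = b_n u_{n-1} + a_n u_{n-2}. *)
Fixpoint cf_rec (a b : nat -> R) (u v : R) (n : nat) : R * R :=
  match n with
  | O => (u, v)
  | S m => let p := cf_rec a b u v m in
           (b (S m) * fst p + a (S m) * snd p, fst p)
  end.

Definition cf_P (a b : nat -> R) (b0 : R) (n : nat) : R * R := cf_rec a b b0 1 n.
Definition cf_Q (a b : nat -> R) (n : nat) : R * R := cf_rec a b 1 0 n.

Fixpoint cf_prod (a : nat -> R) (n : nat) : R :=
  match n with O => 1 | S m => cf_prod a m * a (S m) end.

Definition cf_pos (a b : nat -> R) : Prop :=
  forall n, (1 <= n)%nat -> 0 < a n /\ 0 < b n.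

Lemma cf_tail_ge0 a b : cf_pos a b ->
  forall n k, (1 <= k)%nat -> 0 <= cf_tail a b k n.
Proof.
  intros Hab n; induction n as [|n IH]; intros k Hk; simpl; [lra|].
  destruct (Hab k Hk) as [Ha Hb].
  pose proof (IH (S k) ltac:(lia)).
  apply Rlt_le, Rdiv_lt_0_compat; lra.
Qed.

Lemma cf_tail_le a b : cf_pos a b ->
  forall n k, (1 <= k)%nat -> cf_tail a b k n <= a k / b k.
Proof.
  intros Hab n k Hk; destruct (Hab k Hk) as [Ha Hb].
  destruct n as [|n]; simpl.
  - apply Rlt_le, Rdiv_lt_0_compat; lra.
  - pose proof (cf_tail_ge0 a b Hab n (S k) ltac:(lia)).
    apply Rmult_le_compat_l; [lra|]. apply Rinv_le_contravar; lra.
Qed.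

Lemma cf_rec_pos a b u v : cf_pos a b -> 0 < u -> 0 <= v ->
  forall n, 0 < fst (cf_rec a b u v n) /\ 0 <= snd (cf_rec a b u v n) /\
            ((1 <= n)%nat -> 0 < snd (cf_rec a b u v n)).
Proof.
  intros Hab Hu Hv n; induction n as [|n [IH1 [IH2 _]]]; simpl.
  - repeat split; try lra. lia.
  - destruct (Hab (S n) ltac:(lia)) as [Ha Hb].
    split; [|split; intros; lra].
    pose proof (Rmult_lt_0_compat _ _ Hb IH1).
    pose proof (Rmult_le_pos _ _ (Rlt_le _ _ Ha) IH2). lra.
Qed.

Lemma cf_prod_pos a b : cf_pos a b -> forall n, 0 < cf_prod a n.
Proof.
  intros Hab n; induction n as [|n IH]; simpl; [lra|].
  apply Rmult_lt_0_compat; [assumption|apply Hab; lia].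
Qed.

(** Appending a tail [t] is a Möbius transformation given by [cf_P] and [cf_Q]. The induction is
    over all [k]: unfolding one level of the tail is one step of the recurrence. *)
Lemma cf_convergent_shift a b b0 : cf_pos a b ->
  forall n k, let t := cf_tail a b (S k) n in
  fst (cf_P a b b0 (k + n)) / fst (cf_Q a b (k + n)) =
  (fst (cf_P a b b0 k) + t * snd (cf_P a b b0 k)) /
  (fst (cf_Q a b k) + t * snd (cf_Q a b k)).
Proof.
  intros Hab n; induction n as [|n IH]; intros k.
  - simpl. rewrite Nat.add_0_r, !Rmult_0_l, !Rplus_0_r. reflexivity.
  - cbv zeta. replace (k + S n)%nat with (S k + n)%nat by lia.
    rewrite (IH (S k)). simpl cf_tail.
    set (t := cf_tail a b (S (S k)) n).
    assert (Ht : 0 <= t) by (apply cf_tail_ge0; [assumption|lia]).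
    destruct (Hab (S k) ltac:(lia)) as [Ha Hb].
    destruct (cf_rec_pos a b 1 0 Hab ltac:(lra) ltac:(lra) k) as [H1 [H2 _]].
    unfold cf_P, cf_Q in *. simpl.
    set (p := cf_rec a b b0 1 k) in *. set (q := cf_rec a b 1 0 k) in *.
    pose proof (Rmult_lt_0_compat _ _ Hb H1).
    pose proof (Rmult_le_pos _ _ (Rlt_le _ _ Ha) H2).
    pose proof (Rmult_le_pos _ _ Ht (Rlt_le _ _ H1)).
    field; repeat split; lra.
Qed.

Lemma cf_convergent a b b0 : cf_pos a b -> forall n,
  b0 + cf_conv a b n = fst (cf_P a b b0 n) / fst (cf_Q a b n).
Proof.
  intros Hab n. pose proof (cf_convergent_shift a b b0 Hab n 0) as H.
  simpl in H. rewrite H. unfold cf_conv. field.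
Qed.

(** The classical determinant formula: each step multiplies the determinant by [- a (S n)]. *)
Lemma cf_det a b b0 n :
  fst (cf_P a b b0 n) * snd (cf_Q a b n) - snd (cf_P a b b0 n) * fst (cf_Q a b n)
  = - (-1) ^ n * cf_prod a n.
Proof.
  unfold cf_P, cf_Q. induction n as [|n IH]; simpl; [ring|].
  replace (- (-1 * (-1) ^ n) * (cf_prod a n * a (S n)))
    with (- a (S n) * (- (-1) ^ n * cf_prod a n)) by ring.
  rewrite <- IH. ring.
Qed.

(** * Gaps between convergents and a convergence criterion *)

(* The reciprocal of |C_n - C_{n-1}|. *)
Definition cf_gap (a b : nat -> R) (n : nat) : R :=
  fst (cf_Q a b n) * snd (cf_Q a b n) / cf_prod a n.

(** A later convergent is the Möbius image of some t >= 0, so it lies between C_n (t = 0) and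
    C_(n-1) (t infinite), whose distance the determinant formula evaluates. *)
Lemma cf_conv_gap a b : cf_pos a b -> forall n m, (1 <= n)%nat -> (n <= m)%nat ->
  Rabs (cf_conv a b m - cf_conv a b n) <= / cf_gap a b n.
Proof.
  intros Hab n m Hn Hm.
  pose proof (cf_convergent a b 0 Hab m) as Cm.
  pose proof (cf_convergent a b 0 Hab n) as Cn.
  rewrite Rplus_0_l in Cm, Cn. rewrite Cm, Cn.
  replace m with (n + (m - n))%nat by lia.
  rewrite cf_convergent_shift by assumption.
  set (t := cf_tail a b (S n) (m - n)).
  assert (Ht : 0 <= t) by (apply cf_tail_ge0; [assumption|lia]).
  pose proof (cf_det a b 0 n) as Hd.
  destruct (cf_rec_pos a b 1 0 Hab ltac:(lra) ltac:(lra) n) as [H1 [_ H2]].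
  specialize (H2 Hn). pose proof (cf_prod_pos a b Hab n) as Hp.
  unfold cf_gap. unfold cf_Q in *.
  set (p := cf_P a b 0 n) in *. set (q := cf_rec a b 1 0 n) in *.
  set (A := cf_prod a n) in *.
  pose proof (Rmult_le_pos _ _ Ht (Rlt_le _ _ H2)).
  replace ((fst p + t * snd p) / (fst q + t * snd q) - fst p / fst q)
    with (- t * (fst p * snd q - snd p * fst q) / ((fst q + t * snd q) * fst q))
    by (field; lra).
  rewrite Hd.
  replace (- t * (- (-1) ^ n * A) / ((fst q + t * snd q) * fst q))
    with ((-1) ^ n * (A / (fst q * snd q) * (t * snd q / (fst q + t * snd q))))
    by (field; lra).
  rewrite Rabs_mult, pow_1_abs, Rmult_1_l.
  assert (0 < A / (fst q * snd q)).
  { apply Rdiv_lt_0_compat; [assumption|]. apply Rmult_lt_0_compat; assumption. }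
  assert (0 <= t * snd q / (fst q + t * snd q) <= 1).
  { split; [apply Rdiv_le_0_compat; lra|]. apply Rle_div_l; lra. }
  rewrite Rabs_pos_eq by (apply Rmult_le_pos; lra).
  replace (/ (fst q * snd q / A)) with (A / (fst q * snd q) * 1) by (field; lra).
  apply Rmult_le_compat_l; lra.
Qed.

(** In Q_(n+1) = b Q_n + a Q_(n-1), the [a] part reproduces the old gap and the [b] part is the
    increment. *)
Lemma cf_gap_S a b : cf_pos a b -> forall n,
  cf_gap a b (S n) = cf_gap a b n + b (S n) * fst (cf_Q a b n) ^ 2 / cf_prod a (S n).
Proof.
  intros Hab n. pose proof (cf_prod_pos a b Hab n).
  destruct (Hab (S n) ltac:(lia)).
  unfold cf_gap, cf_Q. simpl. field. lra.
Qed.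

Lemma cf_gap_incr a b : cf_pos a b -> forall n, cf_gap a b n < cf_gap a b (S n).
Proof.
  intros Hab n. rewrite cf_gap_S by assumption.
  pose proof (cf_prod_pos a b Hab (S n)).
  destruct (Hab (S n) ltac:(lia)) as [_ Hb].
  destruct (cf_rec_pos a b 1 0 Hab ltac:(lra) ltac:(lra) n) as [H1 _].
  assert (0 < b (S n) * fst (cf_Q a b n) ^ 2 / cf_prod a (S n)); [|lra].
  apply Rdiv_lt_0_compat; [|assumption].
  apply Rmult_lt_0_compat; [assumption|]. apply pow_lt; assumption.
Qed.

Lemma cf_gap_ge1 a b : cf_pos a b -> forall n, 0 < cf_gap a b 1 <= cf_gap a b (S n).
Proof.
  intros Hab n. split.
  - apply Rle_lt_trans with (cf_gap a b 0).
    + unfold cf_gap; simpl; lra.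
    + apply cf_gap_incr; assumption.
  - induction n; [lra|]. pose proof (cf_gap_incr a b Hab (S n)). lra.
Qed.

(* AM-GM applied to two consecutive increments of [cf_gap]. *)
Lemma cf_gap_SS a b K : cf_pos a b -> 0 < K ->
  (forall n, (1 <= n)%nat -> a (S n) <= (K * INR (S n)) ^ 2 * (b n * b (S n))) ->
  forall n, cf_gap a b n + cf_gap a b 1 / (K * INR (S (S n))) <= cf_gap a b (S (S n)).
Proof.
  intros Hab HK Hle n.
  destruct (cf_gap_ge1 a b Hab n) as [Hg1 Hg].
  assert (Hw : cf_gap a b (S n) = fst (cf_Q a b (S n)) * fst (cf_Q a b n) / cf_prod a (S n))
    by reflexivity.
  rewrite (cf_gap_S a b Hab (S n)), (cf_gap_S a b Hab n).
  pose proof (cf_prod_pos a b Hab (S n)) as Hp.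
  destruct (Hab (S n) ltac:(lia)) as [_ Hb1].
  destruct (Hab (S (S n)) ltac:(lia)) as [Ha2 Hb2].
  destruct (cf_rec_pos a b 1 0 Hab ltac:(lra) ltac:(lra) n) as [H1 _].
  destruct (cf_rec_pos a b 1 0 Hab ltac:(lra) ltac:(lra) (S n)) as [H2 _].
  specialize (Hle (S n) ltac:(lia)).
  assert (HN : 0 < INR (S (S n))) by (apply lt_0_INR; lia).
  change (cf_prod a (S (S n))) with (cf_prod a (S n) * a (S (S n))).
  fold (cf_Q a b n) in H1. fold (cf_Q a b (S n)) in H2.
  set (N := INR (S (S n))) in *.
  set (q1 := fst (cf_Q a b n)) in *. set (q2 := fst (cf_Q a b (S n))) in *.
  set (p := cf_prod a (S n)) in *.
  set (w := cf_gap a b (S n)) in *.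
  set (x1 := b (S n) * q1 ^ 2 / p).
  set (x2 := b (S (S n)) * q2 ^ 2 / (p * a (S (S n)))).
  assert (KN : 0 < K * N) by (apply Rmult_lt_0_compat; assumption).
  assert (Hx1 : 0 < x1).
  { apply Rdiv_lt_0_compat; [|assumption].
    apply Rmult_lt_0_compat; [assumption|apply pow_lt; assumption]. }
  assert (Hx2 : 0 < x2).
  { apply Rdiv_lt_0_compat; [|apply Rmult_lt_0_compat; assumption].
    apply Rmult_lt_0_compat; [assumption|apply pow_lt; assumption]. }
  (* In the product of the two increments the [cf_Q] factors combine to [w ^ 2]; the remaining b b'
     / a is bounded below by hypothesis. *)
  assert (Hxx : (w / (K * N)) ^ 2 <= x1 * x2).
  { replace (x1 * x2) with (w ^ 2 * (b (S n) * b (S (S n)) / a (S (S n)))).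
    2:{ unfold x1, x2; rewrite Hw; field; lra. }
    replace ((w / (K * N)) ^ 2) with (w ^ 2 * / ((K * N) ^ 2)) by (field; lra).
    apply Rmult_le_compat_l; [apply pow2_ge_0|].
    apply Rmult_le_reg_l with ((K * N) ^ 2); [apply pow_lt; lra|].
    rewrite Rinv_r by (apply pow_nonzero; lra).
    apply Rmult_le_reg_r with (a (S (S n))); [assumption|].
    replace ((K * N) ^ 2 * (b (S n) * b (S (S n)) / a (S (S n))) * a (S (S n)))
      with ((K * N) ^ 2 * (b (S n) * b (S (S n)))) by (field; lra). lra. }
  assert (Hle2 : cf_gap a b 1 / (K * N) <= w / (K * N)).
  { apply Rmult_le_compat_r; [apply Rlt_le, Rinv_0_lt_compat; assumption|assumption]. }
  assert (0 < w / (K * N)) by (apply Rdiv_lt_0_compat; lra).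
  assert (w / (K * N) <= x1 + x2); [|lra].
  apply Rnot_lt_le; intro Hlt. nra.
Qed.

(** Gains proportional to 1/n over every two steps add up like the harmonic series. *)
Lemma cf_gap_ln a b K : cf_pos a b -> 0 < K ->
  (forall n, (1 <= n)%nat -> a (S n) <= (K * INR (S n)) ^ 2 * (b n * b (S n))) ->
  exists d, 0 < d /\ forall n, d * ln (INR (S n)) <= cf_gap a b n.
Proof.
  intros Hab HK Hle.
  destruct (cf_gap_ge1 a b Hab 0) as [Hg1 _].
  set (g := cf_gap a b 1) in *.
  (* The bound [g / (4 * K)] serves the induction step, where ln(n+3) - ln(n+1) <= 2/(n+1) <=
     4/(n+2); the bound [g] serves the start, d ln 2 <= g. *)
  exists (Rmin (g / (4 * K)) g). split.
  { apply Rmin_pos; [apply Rdiv_lt_0_compat; lra|assumption]. }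
  set (d := Rmin (g / (4 * K)) g).
  assert (Hd0 : 0 < d) by (apply Rmin_pos; [apply Rdiv_lt_0_compat; lra|assumption]).
  assert (Hd1 : d <= g / (4 * K)) by apply Rmin_l.
  assert (Hd2 : d <= g) by apply Rmin_r.
  assert (Hln : forall x y, 0 < x -> 0 < y -> ln y - ln x <= y / x - 1).
  { intros x y Hx Hy. rewrite <- ln_div by assumption.
    pose proof (exp_ineq1_le (ln (y / x))) as H.
    rewrite exp_ln in H by (apply Rdiv_lt_0_compat; assumption). lra. }
  (* Consecutive pairs, because [cf_gap_SS] advances by two. *)
  assert (Hpair : forall n, d * ln (INR (S n)) <= cf_gap a b n /\
                            d * ln (INR (S (S n))) <= cf_gap a b (S n)).
  { induction n as [|n [IH1 IH2]].
    - split.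
      + replace (INR 1) with 1 by reflexivity. rewrite ln_1. unfold cf_gap; simpl; lra.
      + fold g. pose proof (Hln 1 2 ltac:(lra) ltac:(lra)) as H.
        rewrite ln_1 in H. replace (INR 2) with 2 by (simpl; lra). nra.
    - split; [assumption|].
      eapply Rle_trans; [|apply (cf_gap_SS a b K Hab HK Hle n)]. fold g.
      assert (HN : 0 < INR (S n)) by (apply lt_0_INR; lia).
      rewrite !(S_INR (S _)) in *. rewrite S_INR in *.
      pose proof (pos_INR n).
      set (N := INR n) in *.
      pose proof (Hln (N + 1) (N + 1 + 1 + 1) ltac:(lra) ltac:(lra)) as H0.
      assert ((N + 1 + 1 + 1) / (N + 1) - 1 <= 4 / (N + 1 + 1)).
      { replace ((N + 1 + 1 + 1) / (N + 1) - 1) with (2 / (N + 1)) by (field; lra).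
        apply Rle_div_l; [lra|].
        replace (4 / (N + 1 + 1) * (N + 1)) with (2 + 2 * N / (N + 1 + 1)) by (field; lra).
        assert (0 <= 2 * N / (N + 1 + 1)) by (apply Rdiv_le_0_compat; lra). lra. }
      assert (d * (4 / (N + 1 + 1)) <= g / (K * (N + 1 + 1))).
      { replace (g / (K * (N + 1 + 1))) with (g / (4 * K) * (4 / (N + 1 + 1)))
          by (field; lra).
        apply Rmult_le_compat_r; [apply Rdiv_le_0_compat; lra|assumption]. }
      nra. }
  intro n; apply Hpair.
Qed.

Lemma cf_converges_of_quadratic a b K : cf_pos a b -> 0 < K ->
  (forall n, (1 <= n)%nat -> a (S n) <= (K * INR (S n)) ^ 2 * (b n * b (S n))) ->
  cf_converges a b.
Proof.
  intros Hab HK Hle. apply ex_lim_seq_cauchy_corr.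
  intro eps. destruct (cf_gap_ln a b K Hab HK Hle) as [d [Hd Hln]].
  (* Chosen so that d ln(n+2) > 2/eps, which puts all later convergents within eps/2 of the one at
     [S n]. *)
  destruct (INR_unbounded (exp (2 / (d * eps) + 1))) as [n Hn].
  assert (He := cond_pos eps).
  assert (Hde : 0 < d * eps) by (apply Rmult_lt_0_compat; lra).
  assert (Hb : 2 / eps < cf_gap a b (S n)).
  { eapply Rlt_le_trans; [|apply Hln].
    assert (2 / (d * eps) < ln (INR (S (S n)))).
    { rewrite <- (ln_exp (2 / (d * eps))). apply ln_increasing; [apply exp_pos|].
      rewrite !S_INR. rewrite exp_plus in Hn.
      pose proof (exp_pos (2 / (d * eps))). pose proof (exp_ineq1_le 1). nra. }
    replace (2 / eps) with (d * (2 / (d * eps))) by (field; lra).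
    apply Rmult_lt_compat_l; assumption. }
  assert (Hi : / cf_gap a b (S n) < eps / 2).
  { replace (eps / 2) with (/ (2 / eps)) by (field; lra).
    apply Rinv_lt_contravar; [|assumption].
    apply Rmult_lt_0_compat; [apply Rdiv_lt_0_compat; lra|].
    destruct (cf_gap_ge1 a b Hab n); lra. }
  exists (S n). intros i j Hni Hnj.
  pose proof (cf_conv_gap a b Hab (S n) i ltac:(lia) Hni) as H1.
  pose proof (cf_conv_gap a b Hab (S n) j ltac:(lia) Hnj) as H2.
  replace (cf_conv a b i - cf_conv a b j)
    with ((cf_conv a b i - cf_conv a b (S n)) - (cf_conv a b j - cf_conv a b (S n))) by ring.
  eapply Rle_lt_trans; [apply Rabs_triang|]. rewrite Rabs_Ropp. lra.
Qed.

Lemma cf_value_lim a b : cf_converges a b -> is_lim_seq (cf_conv a b) (cf_value a b).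
Proof. intro H. apply Lim_seq_correct'; assumption. Qed.

Lemma cf_value_bounds a b : cf_pos a b -> cf_converges a b ->
  0 <= cf_value a b <= a 1%nat / b 1%nat.
Proof.
  intros Hab Hc. pose proof (cf_value_lim a b Hc) as Hl. split.
  - apply (is_lim_seq_le (fun _ => 0) (cf_conv a b) 0 (cf_value a b)); auto.
    + intro n; apply cf_tail_ge0; [assumption|lia].
    + apply is_lim_seq_const.
  - apply (is_lim_seq_le (cf_conv a b) (fun _ => a 1%nat / b 1%nat)
             (cf_value a b) (a 1%nat / b 1%nat)); auto.
    + intro n; apply cf_tail_le; [assumption|lia].
    + apply is_lim_seq_const.
Qed.

(** Even terms force l >= 0, odd terms l <= 0. Convergence and the sign of an error thus replace any
    estimate of its size. *)
Lemma is_lim_seq_alternating u (l : R) : is_lim_seq u l ->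
  (forall n, 0 <= (-1) ^ n * u n) -> l = 0.
Proof.
  intros Hl Hs.
  assert (Ho : is_lim_seq (fun n => - u (S (2 * n))) (- l)).
  { apply (proj1 (is_lim_seq_opp (fun n => u (S (2 * n))) l)). apply is_lim_seq_subseq with (phi := fun n => S (2 * n)); [|exact Hl].
    apply eventually_subseq; intro n; lia. }
  assert (He : is_lim_seq (fun n => u (2 * n)%nat) l).
  { apply is_lim_seq_subseq with (phi := fun n => (2 * n)%nat); [|exact Hl].
    apply eventually_subseq; intro n; lia. }
  assert (0 <= - l).
  { refine (is_lim_seq_le (fun _ => 0) _ 0 (- l) _ (is_lim_seq_const 0) Ho).
    intro n. specialize (Hs (S (2 * n))). rewrite pow_1_odd in Hs. lra. }
  assert (0 <= l).
  { refine (is_lim_seq_le (fun _ => 0) _ 0 l _ (is_lim_seq_const 0) He).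
    intro n. specialize (Hs (2 * n)%nat). rewrite pow_1_even in Hs. lra. }
  lra.
Qed.

(** * Functional equations of the two continued fractions *)

Lemma y_pos r t : 1 / 2 < r -> 0 < t -> cf_pos (y_num r) (y_den t).
Proof.
  intros Hr Ht n Hn. unfold y_num, y_den.
  assert (1 <= INR n) by (apply (le_INR 1); assumption).
  split; [|lra].
  (* Difference of squares: both factors are positive for n >= 1 and r > 1/2. *)
  replace ((2 * INR n - 1) ^ 2 * r ^ 2 - (r - 1) ^ 2)
    with (((2 * INR n - 2) * r + 1) * (2 * INR n * r - 1)) by ring.
  apply Rmult_lt_0_compat; nra.
Qed.

Lemma y_converges r t : 1 / 2 < r -> 0 < t -> cf_converges (y_num r) (y_den t).
Proof.
  (* This [K] turns the right side of the criterion into (2n+2)^2 r^2, which dominates (2n+1)^2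
     r^2. *)
  intros Hr Ht. apply cf_converges_of_quadratic with (K := r / t).
  - apply y_pos; assumption.
  - apply Rdiv_lt_0_compat; lra.
  - intros n Hn. unfold y_num, y_den. rewrite S_INR.
    pose proof (pos_INR n).
    replace ((r / t * (INR n + 1)) ^ 2 * (2 * t * (2 * t)))
      with ((2 * INR n + 2) ^ 2 * r ^ 2) by (field; lra).
    pose proof (pow2_ge_0 (r - 1)).
    assert ((2 * (INR n + 1) - 1) ^ 2 <= (2 * INR n + 2) ^ 2) by (apply pow_incr; lra).
    pose proof (pow2_ge_0 r). nra.
Qed.

(** Supplies the positivity of y and the asymptotics y(t) = t + O(1/t) that single out ln y among
    the solutions of its equation. *)
Lemma y_fun_bounds r t : 1 / 2 < r -> 0 < t ->
  t <= y_fun t r <= t + y_num r 1 / (2 * t).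
Proof.
  intros Hr Ht.
  pose proof (cf_value_bounds _ _ (y_pos r t Hr Ht) (y_converges r t Hr Ht)) as H.
  change (y_den t 1) with (2 * t) in H. unfold y_fun. lra.
Qed.

Lemma is_lim_cf_ratio a b b0 : cf_pos a b -> cf_converges a b ->
  is_lim_seq (fun n => fst (cf_P a b b0 n) / fst (cf_Q a b n)) (b0 + cf_value a b).
Proof.
  intros Hab Hc.
  apply is_lim_seq_ext with (fun n => b0 + cf_conv a b n).
  - intro n; apply cf_convergent; assumption.
  - apply is_lim_seq_plus'; [apply is_lim_seq_const|].
    apply cf_value_lim; assumption.
Qed.

(* Wallis' computation for Brouncker's fraction, carried out on the convergents
   of y(t) and y(t+2r) simultaneously. *)
Lemma y_wallis r t n :
  let G := (t + r) ^ 2 - (r - 1) ^ 2 in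
  let P := cf_P (y_num r) (y_den t) t n in
  let Q := cf_Q (y_num r) (y_den t) n in
  let P' := cf_P (y_num r) (y_den (t + 2 * r)) (t + 2 * r) n in
  let Q' := cf_Q (y_num r) (y_den (t + 2 * r)) n in
  let w := (-1) ^ n * cf_prod (y_num r) n in
  fst P * fst P' - G * (fst Q * fst Q') = - w * y_num r (S n) /\
  fst P * snd P' - G * (fst Q * snd Q') = w * (t - 2 * INR n * r) /\
  snd P * fst P' - G * (snd Q * fst Q') = w * (t + 2 * r + 2 * INR n * r) /\
  snd P * snd P' - G * (snd Q * snd Q') = w.
Proof.
  (* The four pairings are carried together because the recurrence expresses each new one through
     the old ones. *)
  cbv zeta. unfold cf_P, cf_Q. induction n as [|n (H1 & H2 & H3 & H4)].
  - unfold y_num; simpl. repeat split; ring.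
  - simpl cf_rec. simpl cf_prod. cbn [fst snd].
    change (y_den t (S n)) with (2 * t). change (y_den (t + 2 * r) (S n)) with (2 * (t + 2 * r)).
    set (G := (t + r) ^ 2 - (r - 1) ^ 2) in *.
    set (P := cf_rec (y_num r) (y_den t) t 1 n) in *.
    set (Q := cf_rec (y_num r) (y_den t) 1 0 n) in *.
    set (P' := cf_rec (y_num r) (y_den (t + 2 * r)) (t + 2 * r) 1 n) in *.
    set (Q' := cf_rec (y_num r) (y_den (t + 2 * r)) 1 0 n) in *.
    set (w := cf_prod (y_num r) n) in *.
    set (v := cf_prod (y_num r) n) in *.
    rewrite <- tech_pow_Rmult, S_INR.
    set (e := (-1) ^ n) in *.
    assert (Ha : y_num r (S (S n)) = y_num r (S n) + 8 * r ^ 2 * (INR n + 1))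
      by (unfold y_num; rewrite !S_INR; ring).
    rewrite Ha. set (a := y_num r (S n)) in *. set (N := INR n) in *.
    set (d := t + 2 * r) in *.
    repeat split.
    + transitivity (4 * t * d * (fst P * fst P' - G * (fst Q * fst Q'))
        + 2 * t * a * (fst P * snd P' - G * (fst Q * snd Q'))
        + 2 * d * a * (snd P * fst P' - G * (snd Q * fst Q'))
        + a ^ 2 * (snd P * snd P' - G * (snd Q * snd Q'))); [ring|].
      rewrite H1, H2, H3, H4. unfold d. ring.
    + transitivity (2 * t * (fst P * fst P' - G * (fst Q * fst Q'))
        + a * (snd P * fst P' - G * (snd Q * fst Q'))); [ring|].
      rewrite H1, H3. unfold d. ring.
    + transitivity (2 * d * (fst P * fst P' - G * (fst Q * fst Q'))
        + a * (fst P * snd P' - G * (fst Q * snd Q'))); [ring|].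
      rewrite H1, H2. unfold d. ring.
    + rewrite H1. ring.
Qed.

(** By the first identity of [y_wallis], G minus the product of the two convergents is (-1)^n times
    a positive quantity; as both fractions converge, the limit is 0. *)
Lemma y_fun_eq r t : 1 / 2 < r -> 0 < t ->
  y_fun t r * y_fun (t + 2 * r) r = (t + r) ^ 2 - (r - 1) ^ 2.
Proof.
  intros Hr Ht. assert (Ht' : 0 < t + 2 * r) by lra.
  pose proof (is_lim_cf_ratio _ _ t (y_pos r t Hr Ht) (y_converges r t Hr Ht)) as L1.
  pose proof (is_lim_cf_ratio _ _ (t + 2 * r) (y_pos r _ Hr Ht') (y_converges r _ Hr Ht')) as L2.
  fold (y_fun t r) in L1. fold (y_fun (t + 2 * r) r) in L2.
  symmetry. apply Rminus_diag_uniq.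
  eapply is_lim_seq_alternating.
  - apply is_lim_seq_minus'; [apply is_lim_seq_const|].
    apply (is_lim_seq_mult' _ _ _ _ L1 L2).
  - intro n. cbv beta.
    destruct (y_wallis r t n) as [H _]. cbv zeta in H.
    destruct (cf_rec_pos _ _ 1 0 (y_pos r t Hr Ht) ltac:(lra) ltac:(lra) n) as [Q1 _].
    destruct (cf_rec_pos _ _ 1 0 (y_pos r _ Hr Ht') ltac:(lra) ltac:(lra) n) as [Q2 _].
    fold (cf_Q (y_num r) (y_den t) n) in Q1.
    fold (cf_Q (y_num r) (y_den (t + 2 * r)) n) in Q2.
    pose proof (cf_prod_pos _ _ (y_pos r t Hr Ht) n) as Hp.
    destruct (y_pos r t Hr Ht (S n) ltac:(lia)) as [Ha _].
    set (G := (t + r) ^ 2 - (r - 1) ^ 2) in *.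
    set (P := fst (cf_P (y_num r) (y_den t) t n)) in *.
    set (Q := fst (cf_Q (y_num r) (y_den t) n)) in *.
    set (P' := fst (cf_P (y_num r) (y_den (t + 2 * r)) (t + 2 * r) n)) in *.
    set (Q' := fst (cf_Q (y_num r) (y_den (t + 2 * r)) n)) in *.
    replace (G - P / Q * (P' / Q')) with (- (P * P' - G * (Q * Q')) / (Q * Q'))
      by (field; lra).
    rewrite H.
    replace ((-1) ^ n * (- (- ((-1) ^ n * cf_prod (y_num r) n) * y_num r (S n)) / (Q * Q')))
      with (((-1) ^ n) ^ 2 * (cf_prod (y_num r) n * y_num r (S n) / (Q * Q')))
      by (field; lra).
    apply Rmult_le_pos; [apply pow2_ge_0|].
    apply Rdiv_le_0_compat; [apply Rlt_le|]; apply Rmult_lt_0_compat; assumption.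
Qed.

(** * The fraction with denominators alternating between 1 and c *)

Lemma tk_pos A c : 0 < A -> 0 < c -> cf_pos (tk_num A) (tk_den c).
Proof.
  intros HA Hc n Hn. unfold tk_num, tk_den. split.
  - apply Rmult_lt_0_compat; [assumption|]. apply pow_lt, lt_0_INR.
    apply Nat.div_str_pos. lia.
  - destruct (Nat.odd n); lra.
Qed.

Lemma tk_num_odd A m : tk_num A (S (2 * m)) = A * (INR m + 1) ^ 2.
Proof.
  unfold tk_num. rewrite <- S_INR. f_equal. f_equal. f_equal.
  symmetry; apply Nat.div_unique with 0%nat; lia.
Qed.

Lemma tk_num_even A m : tk_num A (S (S (2 * m))) = A * (INR m + 1) ^ 2.
Proof.
  unfold tk_num. rewrite <- S_INR. f_equal. f_equal. f_equal.
  symmetry; apply Nat.div_unique with 1%nat; lia.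
Qed.

Lemma tk_den_odd c m : tk_den c (S (2 * m)) = 1.
Proof.
  unfold tk_den. rewrite Nat.odd_succ, Nat.even_mul. reflexivity.
Qed.

Lemma tk_den_even c m : tk_den c (S (S (2 * m))) = c.
Proof.
  unfold tk_den. rewrite Nat.odd_succ_succ, Nat.odd_mul. reflexivity.
Qed.

Lemma tk_converges A c : 0 < A -> 0 < c -> cf_converges (tk_num A) (tk_den c).
Proof.
  (* Two consecutive denominators have product [c], so with this [K] the criterion reads tk_num(n+1)
     <= A (n+1)^2. *)
  intros HA Hc. apply cf_converges_of_quadratic with (K := sqrt (A / c)).
  - apply tk_pos; assumption.
  - apply sqrt_lt_R0, Rdiv_lt_0_compat; assumption.
  - intros n Hn.
    replace (tk_den c n * tk_den c (S n)) with c.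
    2:{ unfold tk_den. rewrite Nat.odd_succ, <- Nat.negb_odd.
        destruct (Nat.odd n); simpl; ring. }
    rewrite Rpow_mult_distr, pow2_sqrt by (apply Rlt_le, Rdiv_lt_0_compat; assumption).
    replace (A / c * INR (S n) ^ 2 * c) with (A * INR (S n) ^ 2) by (field; lra).
    unfold tk_num. apply Rmult_le_compat_l; [lra|].
    apply pow_incr. split; [apply pos_INR|]. apply le_INR.
    apply Nat.Div0.div_le_upper_bound. lia.
Qed.

(* The analogue of [y_wallis] for the fraction X(z-r) = c + TK(4r^2, c) with
   c = (z-r)^2 - r^2, and X(z+r). *)
Lemma tk_wallis r z m :
  let c := z ^ 2 - 2 * z * r in let c' := z ^ 2 + 2 * z * r in
  let A := 4 * r ^ 2 in
  let P := cf_P (tk_num A) (tk_den c) c (2 * m) in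
  let Q := cf_Q (tk_num A) (tk_den c) (2 * m) in
  let P' := cf_P (tk_num A) (tk_den c') c' (2 * m) in
  let Q' := cf_Q (tk_num A) (tk_den c') (2 * m) in
  let w := cf_prod (tk_num A) (2 * m) in
  z ^ 2 * (fst Q * fst P' + fst P * fst Q') - 2 * (fst P * fst P')
    = 2 * w * tk_num A (S (2 * m)) * z ^ 2 /\
  z ^ 2 * (fst Q * snd P' + fst P * snd Q') - 2 * (fst P * snd P')
    = w * (- z ^ 2 + 4 * r * z * (INR m + 1)) /\
  z ^ 2 * (snd Q * fst P' + snd P * fst Q') - 2 * (snd P * fst P')
    = w * (- z ^ 2 - 4 * r * z * (INR m + 1)) /\
  z ^ 2 * (snd Q * snd P' + snd P * snd Q') - 2 * (snd P * snd P') = - 2 * w.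
Proof.
  (* The form z^2 (Q P' + P Q') - 2 P P' is z^2 P P' times the error Q/P + Q'/P' - 2/z^2. The
     induction advances by one period, two steps of the recurrence. *)
  cbv zeta. unfold cf_P, cf_Q. induction m as [|m (H1 & H2 & H3 & H4)].
  - unfold tk_num; simpl. repeat split; ring.
  - rewrite tk_num_odd in *.
    replace (2 * S m)%nat with (S (S (2 * m))) by lia.
    cbn [cf_rec cf_prod fst snd].
    rewrite !tk_den_odd, !tk_den_even, !tk_num_odd, !tk_num_even, S_INR.
    set (c := z ^ 2 - 2 * z * r) in *.
    set (c' := z ^ 2 + 2 * z * r) in *.
    set (P := cf_rec _ (tk_den c) c 1 _) in *.
    set (Q := cf_rec _ (tk_den c) 1 0 _) in *.
    set (P' := cf_rec _ (tk_den c') c' 1 _) in *.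
    set (Q' := cf_rec _ (tk_den c') 1 0 _) in *.
    set (w := cf_prod _ (2 * m)) in *.
    set (N := INR m) in *.
    set (a := 4 * r ^ 2 * (N + 1) ^ 2) in *.
    set (B11 := z ^ 2 * (fst Q * fst P' + fst P * fst Q') - 2 * (fst P * fst P')) in *.
    set (B10 := z ^ 2 * (fst Q * snd P' + fst P * snd Q') - 2 * (fst P * snd P')) in *.
    set (B01 := z ^ 2 * (snd Q * fst P' + snd P * fst Q') - 2 * (snd P * fst P')) in *.
    set (B00 := z ^ 2 * (snd Q * snd P' + snd P * snd Q') - 2 * (snd P * snd P')) in *.
    repeat split.
    + transitivity (c * c' * (B11 + a * B10 + a * B01 + a ^ 2 * B00)
        + c * a * (B11 + a * B01) + c' * a * (B11 + a * B10) + a ^ 2 * B11);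
        [unfold B11, B10, B01, B00; ring|].
      rewrite H1, H2, H3, H4. unfold a, c, c'. ring.
    + transitivity (c * (B11 + a * B10 + a * B01 + a ^ 2 * B00) + a * (B11 + a * B10));
        [unfold B11, B10, B01, B00; ring|].
      rewrite H1, H2, H3, H4. unfold a, c. ring.
    + transitivity (c' * (B11 + a * B10 + a * B01 + a ^ 2 * B00) + a * (B11 + a * B01));
        [unfold B11, B10, B01, B00; ring|].
      rewrite H1, H2, H3, H4. unfold a, c'. ring.
    + transitivity (B11 + a * B10 + a * B01 + a ^ 2 * B00);
        [unfold B11, B10, B01, B00; ring|].
      rewrite H1, H2, H3, H4. ring.
Qed.



(** This is X(a). The values [cfc1] and [cfc2] at s are a^2 - r^2 for a = s+1-r and a = s+r-1, so
    shifting s by 2r shifts a by 2r. *)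
Definition tk_full (r a : R) : R := (a ^ 2 - r ^ 2) + TK (4 * r ^ 2) (a ^ 2 - r ^ 2).

Lemma tk_full_ge r a : 0 < r < a -> a ^ 2 - r ^ 2 <= tk_full r a.
Proof.
  intros [Hr Ha].
  assert (Hc : 0 < a ^ 2 - r ^ 2) by nra.
  assert (HA : 0 < 4 * r ^ 2) by nra.
  pose proof (cf_value_bounds _ _ (tk_pos _ _ HA Hc) (tk_converges _ _ HA Hc)).
  unfold tk_full, TK. lra.
Qed.

Lemma is_lim_inv_tk_full r a : 0 < r < a ->
  let c := a ^ 2 - r ^ 2 in
  is_lim_seq (fun m => fst (cf_Q (tk_num (4 * r ^ 2)) (tk_den c) m) /
                       fst (cf_P (tk_num (4 * r ^ 2)) (tk_den c) c m))
    (/ tk_full r a).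
Proof.
  intros Hra c. pose proof (tk_full_ge r a Hra) as Hge. destruct Hra as [Hr Ha].
  assert (Hc : 0 < c) by (unfold c; nra).
  assert (HA : 0 < 4 * r ^ 2) by nra.
  pose proof (tk_pos _ _ HA Hc) as Hp.
  apply is_lim_seq_ext with (fun n => / (fst (cf_P (tk_num (4 * r ^ 2)) (tk_den c) c n) /
     fst (cf_Q (tk_num (4 * r ^ 2)) (tk_den c) n))).
  { intro n.
    destruct (cf_rec_pos _ _ 1 0 Hp ltac:(lra) ltac:(lra) n) as [H1 _].
    destruct (cf_rec_pos _ _ c 1 Hp ltac:(lra) ltac:(lra) n) as [H2 _].
    unfold cf_P, cf_Q. field; lra. }
  apply (is_lim_seq_inv _ (tk_full r a)).
  - apply is_lim_cf_ratio; [assumption|apply tk_converges; assumption].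
  - intro H. injection H as H. fold c in Hge. lra.
Qed.

(** The error of the convergents is the form in [tk_wallis] divided by z^2 P P' > 0; its sign is
    (-1)^n, so it vanishes in the limit. *)
Lemma tk_full_eq r a : 0 < r < a ->
  / tk_full r a + / tk_full r (a + 2 * r) = 2 / (a + r) ^ 2.
Proof.
  intros [Hr Ha].
  pose proof (is_lim_inv_tk_full r a ltac:(lra)) as L1.
  pose proof (is_lim_inv_tk_full r (a + 2 * r) ltac:(lra)) as L2.
  cbv zeta in L1, L2.
  set (z := a + r) in *.
  assert (Hz : 2 * r < z) by (unfold z; lra).
  replace (a ^ 2 - r ^ 2) with (z ^ 2 - 2 * z * r) in L1 by (unfold z; ring).
  replace ((a + 2 * r) ^ 2 - r ^ 2) with (z ^ 2 + 2 * z * r) in L2 by (unfold z; ring).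
  assert (Hzr : 0 < z * r) by nra.
  assert (Hc : 0 < z ^ 2 - 2 * z * r) by nra.
  assert (Hc' : 0 < z ^ 2 + 2 * z * r) by nra.
  assert (HA : 0 < 4 * r ^ 2) by nra.
  pose proof (tk_pos _ _ HA Hc) as Hp.
  pose proof (tk_pos _ _ HA Hc') as Hp'.
  apply Rminus_diag_uniq.
  eapply is_lim_seq_alternating.
  - apply is_lim_seq_minus'; [|apply is_lim_seq_const].
    apply (is_lim_seq_plus' _ _ _ _ L1 L2).
  - set (c := z ^ 2 - 2 * z * r) in *. set (c' := z ^ 2 + 2 * z * r) in *.
    set (A := 4 * r ^ 2) in *.
    intro n. cbv beta.
    destruct (cf_rec_pos _ _ c 1 Hp ltac:(lra) ltac:(lra) n) as [P1 _].
    destruct (cf_rec_pos _ _ c' 1 Hp' ltac:(lra) ltac:(lra) n) as [P2 _].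
    fold (cf_P (tk_num A) (tk_den c) c n) in P1.
    fold (cf_P (tk_num A) (tk_den c') c' n) in P2.
    assert (HB : 0 <= (-1) ^ n * (z ^ 2 *
       (fst (cf_Q (tk_num A) (tk_den c) n) * fst (cf_P (tk_num A) (tk_den c') c' n) +
        fst (cf_P (tk_num A) (tk_den c) c n) * fst (cf_Q (tk_num A) (tk_den c') n)) -
       2 * (fst (cf_P (tk_num A) (tk_den c) c n) * fst (cf_P (tk_num A) (tk_den c') c' n)))).
    { destruct (Nat.Even_or_Odd n) as [[m ->]|[m Hm]].
      - destruct (tk_wallis r z m) as [H _]. cbv zeta in H. fold c c' A in H.
        rewrite H, pow_1_even, tk_num_odd.
        pose proof (cf_prod_pos _ _ Hp (2 * m)).
        pose proof (pow2_ge_0 z). pose proof (pow2_ge_0 (INR m + 1)).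
        apply Rmult_le_pos; [lra|]. apply Rmult_le_pos; [|assumption].
        apply Rmult_le_pos; [lra|]. apply Rmult_le_pos; lra.
      (* The odd index 2m+1 is read off the [snd] components at 2(m+1), where the form is -2w. *)
      - replace n with (S (2 * m)) by lia.
        destruct (tk_wallis r z (S m)) as (_ & _ & _ & H).
        cbv zeta in H. fold c c' A in H.
        replace (2 * S m)%nat with (S (S (2 * m))) in H by lia.
        pose proof (cf_prod_pos _ _ Hp (S (S (2 * m)))).
        rewrite pow_1_odd.
        match goal with |- 0 <= -1 * ?X =>
          change (X = - 2 * cf_prod (tk_num A) (S (S (2 * m)))) in H; rewrite H end.
        lra. }
    set (P := fst (cf_P (tk_num A) (tk_den c) c n)) in *.
    set (Q := fst (cf_Q (tk_num A) (tk_den c) n)) in *.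
    set (P' := fst (cf_P (tk_num A) (tk_den c') c' n)) in *.
    set (Q' := fst (cf_Q (tk_num A) (tk_den c') n)) in *.
    assert (0 < z ^ 2 * (P * P')).
    { apply Rmult_lt_0_compat; [apply pow_lt; lra|apply Rmult_lt_0_compat; assumption]. }
    replace ((-1) ^ n * (Q / P + Q' / P' - 2 / z ^ 2))
      with ((-1) ^ n * (z ^ 2 * (Q * P' + P * Q') - 2 * (P * P')) / (z ^ 2 * (P * P')))
      by (field; repeat split; try apply pow_nonzero; lra).
    apply Rdiv_le_0_compat; assumption.
Qed.

(** * Differentiation of the alternating series for ln y *)

(** Nested form of the sum of (-1)^j f(t + j d) over j < n: inductions move [t] instead of tracking
    signs. *)
Fixpoint alt_sum (f : R -> R) (d : R) (n : nat) (t : R) : R :=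
  match n with O => 0 | S m => f t - alt_sum f d m (t + d) end.

Lemma alt_sum_remainder (f h : R -> R) d x0 : 0 < d ->
  (forall t, x0 < t -> h t + h (t + d) = f t) ->
  forall n t, x0 < t -> h t - alt_sum f d n t = (-1) ^ n * h (t + INR n * d).
Proof.
  intros Hd Hh n; induction n as [|n IH]; intros t Ht.
  - simpl. rewrite Rmult_0_l, Rplus_0_r. ring.
  - cbn [alt_sum]. rewrite <- tech_pow_Rmult, S_INR, <- Hh by assumption.
    replace (t + (INR n + 1) * d) with (t + d + INR n * d) by ring.
    rewrite Rmult_assoc, <- IH by lra. ring.
Qed.

Lemma alt_sum_bounds (f : R -> R) d x0 : 0 < d ->
  (forall t, x0 < t -> 0 <= f (t + d) <= f t) ->
  forall n t, x0 < t -> 0 <= alt_sum f d n (t + d) <= f (t + d).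
Proof.
  intros Hd Hf n; induction n as [|n IH]; intros t Ht; simpl.
  - specialize (Hf t Ht). lra.
  - pose proof (IH (t + d) ltac:(lra)). pose proof (Hf (t + d) ltac:(lra)). lra.
Qed.

(** Leibniz' error bound: the first [n] terms cancel and leave an alternating sum starting at
    [t + INR n * d]. The bound is uniform in [k]. *)
Lemma alt_sum_tail (f : R -> R) d x0 : 0 < d ->
  (forall t, x0 < t -> 0 <= f (t + d) <= f t) ->
  forall k n t, x0 < t ->
  Rabs (alt_sum f d (n + k) t - alt_sum f d n t) <= f (t + INR n * d).
Proof.
  intros Hd Hf k n; induction n as [|n IH]; intros t Ht.
  - simpl. rewrite Rmult_0_l, Rplus_0_r, Rminus_0_r.
    destruct k as [|k]; simpl.
    + rewrite Rabs_R0. specialize (Hf t Ht). lra.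
    + pose proof (alt_sum_bounds f d x0 Hd Hf k t Ht). specialize (Hf t Ht).
      rewrite Rabs_pos_eq; lra.
  - cbn [alt_sum Nat.add].
    replace (f t - alt_sum f d (n + k) (t + d) - (f t - alt_sum f d n (t + d)))
      with (- (alt_sum f d (n + k) (t + d) - alt_sum f d n (t + d))) by ring.
    rewrite Rabs_Ropp, S_INR.
    replace (t + (INR n + 1) * d) with (t + d + INR n * d) by ring.
    apply IH; lra.
Qed.

Lemma is_derive_alt_sum (f f' : R -> R) d x0 : 0 < d ->
  (forall t, x0 < t -> is_derive f t (f' t)) ->
  forall n t, x0 < t -> is_derive (alt_sum f d n) t (alt_sum f' d n t).
Proof.
  intros Hd Hf n; induction n as [|n IH]; intros t Ht; simpl.
  - apply (is_derive_const (V := R_NormedModule)).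
  - apply (is_derive_minus (V := R_NormedModule)); [apply Hf; assumption|].
    replace (alt_sum f' d n (t + d)) with (scal 1 (alt_sum f' d n (t + d)))
      by apply Rmult_1_l.
    apply (is_derive_comp (alt_sum f d n) (fun u => u + d)).
    + apply IH; lra.
    + auto_derive; [trivial|ring].
Qed.

Lemma alt_sum_opp (f : R -> R) d n t :
  alt_sum (fun u => - f u) d n t = - alt_sum f d n t.
Proof.
  revert t; induction n as [|n IH]; intro t; simpl; [ring|rewrite IH; ring].
Qed.

Lemma is_lim_seq_div_S K : is_lim_seq (fun n => K / INR (S n)) 0.
Proof.
  apply is_lim_seq_ext with (fun n => K * / INR (S n)); [reflexivity|].
  replace (Finite 0) with (Rbar_mult K 0) by (simpl; f_equal; ring).
  apply is_lim_seq_scal_l.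
  apply (is_lim_seq_incr_1 (fun n => / INR n)).
  replace (Finite 0) with (Rbar_inv p_infty) by reflexivity.
  apply is_lim_seq_inv; [apply is_lim_seq_INR|discriminate].
Qed.

Lemma CVU_dom_of_bound (fn : nat -> R -> R) (l : R -> R) (D : R -> Prop) K :
  (forall n x, D x -> Rabs (fn n x - l x) <= K / INR (S n)) ->
  CVU_dom fn D /\ forall x, D x -> real (Lim_seq (fun n => fn n x)) = l x.
Proof.
  intros Hb.
  assert (Hl : forall x, D x -> is_lim_seq (fun n => fn n x) (l x)).
  { intros x Hx. apply is_lim_seq_ext with (fun n => (fn n x - l x) + l x).
    { intro n; ring. }
    replace (Finite (l x)) with (Finite (0 + l x)) by (f_equal; ring).
    apply is_lim_seq_plus'; [|apply is_lim_seq_const].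
    apply is_lim_seq_abs_0.
    apply (is_lim_seq_le_le (fun _ => 0) _ (fun n => K / INR (S n))).
    - intro n; split; [apply Rabs_pos|apply Hb; assumption].
    - apply is_lim_seq_const.
    - apply is_lim_seq_div_S. }
  assert (Hu : forall x, D x -> real (Lim_seq (fun n => fn n x)) = l x).
  { intros x Hx. rewrite (is_lim_seq_unique _ _ (Hl x Hx)). reflexivity. }
  split; [|exact Hu].
  intro eps. pose proof (is_lim_seq_div_S K) as H0.
  apply is_lim_seq_spec in H0. specialize (H0 eps).
  eapply filter_imp; [|exact H0].
  intros n Hn x Hx. rewrite Hu by assumption.
  eapply Rle_lt_trans; [apply Hb; assumption|].
  cbv beta in Hn. rewrite Rminus_0_r in Hn. eapply Rle_lt_trans; [apply Rle_abs|exact Hn].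
Qed.

(** Cauchy criterion for a limit without a closed form at hand, as for the first derivatives of ln
    y. *)
Lemma CVU_dom_of_tail_bound (fn : nat -> R -> R) (D : R -> Prop) K :
  (forall n m x, D x -> (n <= m)%nat -> Rabs (fn m x - fn n x) <= K / INR (S n)) ->
  CVU_dom fn D.
Proof.
  intros Hb. apply CVU_dom_cauchy. intro eps.
  pose proof (is_lim_seq_div_S K) as H0.
  apply is_lim_seq_spec in H0. destruct (H0 (pos_div_2 eps)) as [N HN].
  exists N. intros n m x Hx Hn Hm.
  specialize (HN N (Nat.le_refl N)). cbv beta in HN. rewrite Rminus_0_r in HN. simpl in HN.
  pose proof (Rle_abs (K / INR (S N))) as Ha. simpl in Ha.
  pose proof (Hb N n x Hx Hn) as H1. pose proof (Hb N m x Hx Hm) as H2. simpl in H1, H2.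
  replace (fn n x - fn m x) with ((fn n x - fn N x) - (fn m x - fn N x)) by ring.
  eapply Rle_lt_trans; [apply Rabs_triang|]. rewrite Rabs_Ropp. lra.
Qed.

(** * Term by term differentiation of ln y *)

Section LogDerivative.

Variable r : R.
Hypothesis hr : 1 / 2 < r.

Let x0 := Rmax 1 (2 * r - 1).
Let D (t : R) : Prop := x0 < t.

Definition ln_step (t : R) : R := ln (t + 2 * r - 1) + ln (t + 1).
Definition ln_step' (t : R) : R := / (t + 2 * r - 1) + / (t + 1).
(** Minus the derivative of [ln_step']: this sign makes it nonnegative and equal to the right side
    of the equation for h1 + h2. *)
Definition ln_step'' (t : R) : R := / (t + 2 * r - 1) ^ 2 + / (t + 1) ^ 2.

(* ln y = lim ln_y_approx because ln y(t) + ln y(t+2r) = ln_step t and ln y(t) ~ ln t. *)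
Definition ln_y_approx (n : nat) (t : R) : R :=
  alt_sum ln_step (2 * r) (2 * n) t + ln (t + INR (2 * n) * (2 * r)).
Definition ln_y_approx' (n : nat) (t : R) : R :=
  alt_sum ln_step' (2 * r) (2 * n) t + / (t + INR (2 * n) * (2 * r)).
Definition ln_y_approx'' (n : nat) (t : R) : R :=
  - alt_sum ln_step'' (2 * r) (2 * n) t - / (t + INR (2 * n) * (2 * r)) ^ 2.

Lemma dom_gt t : D t -> 1 < t /\ 2 * r - 1 < t.
Proof.
  unfold D, x0. intro H.
  pose proof (Rmax_l 1 (2 * r - 1)). pose proof (Rmax_r 1 (2 * r - 1)). lra.
Qed.

(** Since 2r > 1, the point t + 4rn outgrows n + 1 independently of t, so estimates at that point
    become uniform on [D]. *)
Lemma shift_ge n t : D t -> INR (S n) <= t + INR (2 * n) * (2 * r).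
Proof.
  intro Ht. destruct (dom_gt t Ht). rewrite S_INR, mult_INR. simpl (INR 2).
  pose proof (pos_INR n). nra.
Qed.

Lemma inv_shift_bound x y : 1 <= x -> x <= y -> 0 < / y <= / x /\ 0 < / y ^ 2 <= / x.
Proof.
  intros Hx Hy. split; split.
  - apply Rinv_0_lt_compat; lra.
  - apply Rinv_le_contravar; lra.
  - apply Rinv_0_lt_compat, pow_lt; lra.
  - apply Rinv_le_contravar; [lra|nra].
Qed.

Lemma INR_S_ge1 n : 1 <= INR (S n).
Proof. apply (le_INR 1); lia. Qed.

Lemma ln_y_step t : D t ->
  ln (y_fun t r) + ln (y_fun (t + 2 * r) r) = ln_step t.
Proof.
  intro Ht. destruct (dom_gt t Ht).
  pose proof (y_fun_bounds r t hr ltac:(lra)).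
  pose proof (y_fun_bounds r (t + 2 * r) hr ltac:(lra)).
  unfold ln_step. rewrite <- !ln_mult by lra.
  rewrite y_fun_eq by lra. f_equal; ring.
Qed.

Lemma ln_y_approx_bound n t : D t ->
  Rabs (ln_y_approx n t - ln (y_fun t r)) <= y_num r 1 / INR (S n).
Proof.
  intro Ht. pose proof (shift_ge n t Ht) as Hs. pose proof (INR_S_ge1 n) as H1.
  assert (Hd : 0 < 2 * r) by lra.
  pose proof (alt_sum_remainder ln_step (fun t => ln (y_fun t r)) (2 * r) x0 Hd
                ln_y_step (2 * n) t Ht) as Hrem.
  (* The number of terms is even, so the remainder has a plus sign and the error is ln u - ln y(u)
     with u = t + 4rn, of size at most a/(2u^2). *)
  rewrite pow_1_even, Rmult_1_l in Hrem. cbv beta in Hrem.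
  unfold ln_y_approx. set (u := t + INR (2 * n) * (2 * r)) in *.
  pose proof (y_fun_bounds r u hr ltac:(lra)) as Hy.
  destruct (y_pos r 1 hr ltac:(lra) 1%nat ltac:(lia)) as [Ha _].
  set (a := y_num r 1) in *.
  assert (Hl : 0 <= ln (y_fun u r) - ln u <= a / INR (S n)).
  { split.
    - assert (ln u <= ln (y_fun u r)); [|lra].
      destruct Hy as [[Hy|Hy] _]; [left; apply ln_increasing; lra|right; f_equal; assumption].
    - rewrite <- ln_div by lra.
      pose proof (exp_ineq1_le (ln (y_fun u r / u))) as H.
      rewrite exp_ln in H by (apply Rdiv_lt_0_compat; lra).
      assert (y_fun u r / u <= 1 + a / 2 * / u ^ 2).
      { apply Rle_div_l; [lra|].
        replace ((1 + a / 2 * / u ^ 2) * u) with (u + a / (2 * u)) by (field; lra). lra. }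
      pose proof (inv_shift_bound _ _ H1 Hs).
      assert (a / 2 * / u ^ 2 <= a * / INR (S n)).
      { apply Rmult_le_compat; lra. }
      unfold Rdiv at 1. lra. }
  apply Rabs_le. lra.
Qed.

(** Leibniz' bound leaves [ln_step'] at t + 4rn, at most 2/(n+1); the two boundary terms add at most
    1/(n+1) each. *)
Lemma ln_y_approx'_tail n m t : D t -> (n <= m)%nat ->
  Rabs (ln_y_approx' m t - ln_y_approx' n t) <= 4 / INR (S n).
Proof.
  intros Ht Hnm. unfold ln_y_approx'.
  pose proof (shift_ge n t Ht) as Hs. pose proof (INR_S_ge1 n) as H1.
  pose proof (shift_ge m t Ht) as Hs'.
  assert (Hnm' : INR (S n) <= INR (S m)) by (apply le_INR; lia).
  assert (Hmono : forall u, x0 < u -> 0 <= ln_step' (u + 2 * r) <= ln_step' u).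
  { intros u Hu. destruct (dom_gt u Hu). unfold ln_step'.
    assert (0 < / (u + 2 * r + 2 * r - 1)) by (apply Rinv_0_lt_compat; lra).
    assert (0 < / (u + 2 * r + 1)) by (apply Rinv_0_lt_compat; lra).
    assert (/ (u + 2 * r + 2 * r - 1) <= / (u + 2 * r - 1)) by (apply Rinv_le_contravar; lra).
    assert (/ (u + 2 * r + 1) <= / (u + 1)) by (apply Rinv_le_contravar; lra).
    lra. }
  pose proof (alt_sum_tail ln_step' (2 * r) x0 ltac:(lra) Hmono
                (2 * m - 2 * n) (2 * n) t Ht) as Htail.
  replace (2 * n + (2 * m - 2 * n))%nat with (2 * m)%nat in Htail by lia.
  set (u := t + INR (2 * n) * (2 * r)) in *.
  set (v := t + INR (2 * m) * (2 * r)) in *.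
  assert (Hu : ln_step' u <= 2 * / INR (S n)).
  { unfold ln_step'.
    pose proof (inv_shift_bound (INR (S n)) (u + 2 * r - 1) H1 ltac:(lra)).
    pose proof (inv_shift_bound (INR (S n)) (u + 1) H1 ltac:(lra)). lra. }
  pose proof (inv_shift_bound _ _ H1 Hs).
  pose proof (inv_shift_bound (INR (S n)) v H1 ltac:(lra)).
  apply Rabs_le_between in Htail. unfold Rdiv.
  apply Rabs_le. lra.
Qed.

Lemma h_sum t : h1 t r + h2 t r =
  / 2 * (/ tk_full r (t + 1 - r) + / tk_full r (t + r - 1)).
Proof.
  unfold h1, h2, tk_full, cfc1, cfc2.
  replace ((t + 1 - r) ^ 2 - r ^ 2) with ((1 - 2 * r + t) * (1 + t)) by ring.
  replace ((t + r - 1) ^ 2 - r ^ 2) with ((2 * r - 1 + t) * (t - 1)) by ring.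
  rewrite <- !Rmult_plus_distr_l. unfold Rdiv. rewrite !Rinv_mult. ring.
Qed.

Lemma h_sum_pos t : D t -> 0 <= h1 t r + h2 t r.
Proof.
  intro Ht. destruct (dom_gt t Ht). rewrite h_sum.
  pose proof (tk_full_ge r (t + 1 - r) ltac:(lra)).
  pose proof (tk_full_ge r (t + r - 1) ltac:(lra)).
  assert (0 < / tk_full r (t + 1 - r)) by (apply Rinv_0_lt_compat; nra).
  assert (0 < / tk_full r (t + r - 1)) by (apply Rinv_0_lt_compat; nra).
  lra.
Qed.

(** This is [tk_full_eq] at a = t+1-r and a = t+r-1, where a + r equals t+1 and t+2r-1. *)
Lemma h_sum_step t : D t ->
  (h1 t r + h2 t r) + (h1 (t + 2 * r) r + h2 (t + 2 * r) r) = ln_step'' t.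
Proof.
  intro Ht. destruct (dom_gt t Ht). rewrite !h_sum.
  pose proof (tk_full_eq r (t + 1 - r) ltac:(lra)) as E1.
  pose proof (tk_full_eq r (t + r - 1) ltac:(lra)) as E2.
  replace (t + 2 * r + 1 - r) with (t + 1 - r + 2 * r) by ring.
  replace (t + 2 * r + r - 1) with (t + r - 1 + 2 * r) by ring.
  replace (t + 1 - r + r) with (t + 1) in E1 by ring.
  replace (t + r - 1 + r) with (t + 2 * r - 1) in E2 by ring.
  unfold Rdiv in E1, E2. unfold ln_step''. lra.
Qed.

(** The remainder is h1 + h2 at u = t + 4rn. Nonnegativity at u + 2r bounds it by [ln_step'' u], at
    most 2/(n+1); 1/u^2 is at most 1/(n+1). *)
Lemma ln_y_approx''_bound n t : D t ->
  Rabs (ln_y_approx'' n t - - (h1 t r + h2 t r)) <= 3 / INR (S n).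
Proof.
  intro Ht. pose proof (shift_ge n t Ht) as Hs. pose proof (INR_S_ge1 n) as H1.
  assert (Hd : 0 < 2 * r) by lra.
  pose proof (alt_sum_remainder ln_step'' (fun t => h1 t r + h2 t r) (2 * r) x0 Hd
                h_sum_step (2 * n) t Ht) as Hrem.
  rewrite pow_1_even, Rmult_1_l in Hrem. cbv beta in Hrem.
  unfold ln_y_approx''.
  assert (Hu : D (t + INR (2 * n) * (2 * r))).
  { unfold D in *. pose proof (pos_INR (2 * n)). nra. }
  set (u := t + INR (2 * n) * (2 * r)) in *.
  pose proof (h_sum_pos u Hu) as P1.
  pose proof (h_sum_pos (u + 2 * r) ltac:(unfold D in *; lra)) as P2.
  pose proof (h_sum_step u Hu) as P3. unfold ln_step'' in P3.
  pose proof (inv_shift_bound _ _ H1 Hs).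
  pose proof (inv_shift_bound (INR (S n)) (u + 2 * r - 1) H1 ltac:(lra)).
  pose proof (inv_shift_bound (INR (S n)) (u + 1) H1 ltac:(lra)).
  unfold Rdiv. apply Rabs_le. lra.
Qed.

Lemma is_derive_ln_y_approx n t : D t -> is_derive (ln_y_approx n) t (ln_y_approx' n t).
Proof.
  intro Ht. pose proof (shift_ge n t Ht). pose proof (INR_S_ge1 n).
  apply (is_derive_plus (V := R_NormedModule)).
  - apply (is_derive_alt_sum ln_step ln_step' (2 * r) x0); [lra| |assumption].
    intros u Hu. destruct (dom_gt u Hu). unfold ln_step, ln_step'.
    auto_derive; [repeat split; lra|field; lra].
  - set (N := INR (2 * n)) in *. clearbody N.
    auto_derive; [lra|field; lra].
Qed.

Lemma is_derive_ln_y_approx' n t : D t -> is_derive (ln_y_approx' n) t (ln_y_approx'' n t).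
Proof.
  intro Ht. pose proof (shift_ge n t Ht). pose proof (INR_S_ge1 n).
  unfold ln_y_approx'', Rminus. rewrite <- alt_sum_opp.
  apply (is_derive_plus (V := R_NormedModule)).
  - apply (is_derive_alt_sum ln_step' _ (2 * r) x0); [lra| |assumption].
    intros u Hu. destruct (dom_gt u Hu). unfold ln_step', ln_step''.
    auto_derive; [repeat split; lra|field; lra].
  - set (N := INR (2 * n)) in *. clearbody N.
    auto_derive; [lra|field; lra].
Qed.

Lemma continuous_ln_y_approx'' n t : D t -> continuous (ln_y_approx'' n) t.
Proof.
  intro Ht. pose proof (shift_ge n t Ht). pose proof (INR_S_ge1 n).
  apply (ex_derive_continuous (V := R_NormedModule)).
  apply (ex_derive_minus (V := R_NormedModule)).
  - apply (ex_derive_opp (V := R_NormedModule)).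
    exists (alt_sum (fun u => - (2 / (u + 2 * r - 1) ^ 3 + 2 / (u + 1) ^ 3)) (2 * r) (2 * n) t).
    apply (is_derive_alt_sum ln_step'' _ (2 * r) x0); [lra| |assumption].
    intros u Hu. destruct (dom_gt u Hu). unfold ln_step''.
    auto_derive; [repeat split; nra|field; lra].
  - set (N := INR (2 * n)) in *. clearbody N.
    auto_derive; nra.
Qed.

Lemma D_open : open D.
Proof. apply open_gt. Qed.

Lemma D_connected : is_connected D.
Proof. unfold D; intros a b x Ha Hb Hx; lra. Qed.

(** The derivatives are known only on [D]; its openness turns equality on [D] into the local
    equality that continuity requires. *)
Lemma CVU_derive_D (fn fn' : nat -> R -> R) :
  CVU_dom fn D -> CVU_dom fn' D ->
  (forall n t, D t -> is_derive (fn n) t (fn' n t)) ->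
  (forall n t, D t -> continuous (fn' n) t) ->
  forall t, D t ->
  is_derive (fun u => real (Lim_seq (fun n => fn n u))) t (real (Lim_seq (fun n => fn' n t))).
Proof.
  intros Hc Hc' Hd Hcont t Ht.
  assert (HD : forall n u, D u -> Derive (fn n) u = fn' n u).
  { intros n u Hu. apply is_derive_unique, Hd, Hu. }
  assert (HDl : forall n u, D u -> locally u (fun v => fn' n v = Derive (fn n) v)).
  { intros n u Hu. eapply filter_imp; [|apply (D_open u Hu)].
    intros v Hv; symmetry; apply HD; exact Hv. }
  replace (real (Lim_seq (fun n => fn' n t))) with
    (real (Lim_seq (fun n => Derive (fn n) t))).
  2:{ f_equal. apply Lim_seq_ext. intro n; apply HD; assumption. }
  apply (CVU_Derive fn D D_open D_connected Hc); [| | |assumption].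
  - intros n u Hu. eexists; apply Hd, Hu.
  - intros n u Hu. apply continuity_pt_filterlim.
    eapply (continuous_ext_loc); [apply HDl, Hu|apply Hcont, Hu].
  - apply CVU_dom_cauchy. apply CVU_dom_cauchy in Hc'.
    intro eps. destruct (Hc' eps) as [N HN]. exists N. intros n m x Hx Hn Hm.
    rewrite !HD by assumption. apply HN; assumption.
Qed.

Lemma ln_y_derivatives :
  (forall t, D t -> ex_derive (fun u => ln (y_fun u r)) t) /\
  (forall t, D t -> is_derive (Derive (fun u => ln (y_fun u r))) t (- (h1 t r + h2 t r))).
Proof.
  destruct (CVU_dom_of_bound _ (fun t => ln (y_fun t r)) D (y_num r 1) ln_y_approx_bound)
    as [C0 L0].
  pose proof (CVU_dom_of_tail_bound ln_y_approx' D 4 ln_y_approx'_tail) as C1.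
  destruct (CVU_dom_of_bound _ (fun t => - (h1 t r + h2 t r)) D 3 ln_y_approx''_bound)
    as [C2 L2].
  (* The first derivative stays an unnamed limit, which the second passage differentiates again. *)
  assert (E1 : forall t, D t -> is_derive (fun u => ln (y_fun u r)) t
                 (real (Lim_seq (fun n => ln_y_approx' n t)))).
  { intros t Ht.
    eapply (is_derive_ext_loc (V := R_NormedModule)).
    2:{ apply (CVU_derive_D _ _ C0 C1 is_derive_ln_y_approx); [|assumption].
        intros n u Hu. apply (ex_derive_continuous (V := R_NormedModule)).
        eexists; apply is_derive_ln_y_approx', Hu. }
    eapply filter_imp; [|apply (D_open t Ht)]. intros u Hu. apply L0, Hu. }
  split.
  - intros t Ht. eexists; apply E1, Ht.
  - intros t Ht.
    eapply (is_derive_ext_loc (V := R_NormedModule)).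
    2:{ rewrite <- L2 by assumption.
        apply (CVU_derive_D _ _ C1 C2 is_derive_ln_y_approx' continuous_ln_y_approx'' t Ht). }
    eapply filter_imp; [|apply (D_open t Ht)]. intros u Hu. symmetry.
    apply is_derive_unique, E1, Hu.
Qed.

End LogDerivative.

(** * The integral *)

Lemma is_RInt_gen_of_lim (f F : R -> R) (l : R) :
  (forall T, 0 <= T -> is_RInt f 0 T (F T)) ->
  is_lim F p_infty l ->
  is_RInt_gen f (at_point 0) (Rbar_locally p_infty) l.
Proof.
  intros HF Hl P HP. destruct (Hl P HP) as [M HM].
  apply Filter_prod with (Q := fun a => a = 0) (R := fun T => Rmax 0 M < T).
  - reflexivity.
  - exists (Rmax 0 M); auto.
  - intros a T -> HT. exists (F T).
    pose proof (Rmax_l 0 M). pose proof (Rmax_r 0 M).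
    split; [apply HF; lra|apply HM; lra].
Qed.

(** The partial integrals are nondecreasing and bounded: they converge along the integers, and
    monotonicity extends this to real T. *)
Lemma is_RInt_gen_bounded (f : R -> R) (M : R) :
  (forall x, continuous f x) -> (forall x, 0 <= x -> 0 <= f x) ->
  (forall T, 0 <= T -> RInt f 0 T <= M) ->
  exists l, 0 <= l /\ is_RInt_gen f (at_point 0) (Rbar_locally p_infty) l.
Proof.
  intros Hc Hf HM.
  assert (Hex : forall a b, ex_RInt f a b).
  { intros a b. apply (ex_RInt_continuous (V := R_CompleteNormedModule)). auto. }
  assert (Hmono : forall a b, 0 <= a -> a <= b -> RInt f 0 a <= RInt f 0 b).
  { intros a b Ha Hab.
    rewrite <- (RInt_Chasles f 0 a b) by apply Hex.
    assert (0 <= RInt f a b); [|change plus with Rplus; lra].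
    apply RInt_ge_0; [assumption|apply Hex|]. intros x Hx; apply Hf; lra. }
  destruct (ex_finite_lim_seq_incr (fun n => RInt f 0 (INR n)) M) as [l Hl].
  - intro n. apply Hmono; [apply pos_INR|apply le_INR; lia].
  - intro n. apply HM, pos_INR.
  - assert (Hle : forall n, RInt f 0 (INR n) <= l).
    { apply (is_lim_seq_incr_compare _ _ Hl).
      intro n. apply Hmono; [apply pos_INR|apply le_INR; lia]. }
    exists l. split.
    { specialize (Hle 0%nat). simpl in Hle. rewrite RInt_point in Hle. exact Hle. }
    apply (is_RInt_gen_of_lim f (RInt f 0)).
    { intros T _. apply (RInt_correct (V := R_CompleteNormedModule)), Hex. }
    apply is_lim_spec. intro eps.
    apply is_lim_seq_spec in Hl. destruct (Hl eps) as [N HN].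
    specialize (HN N (Nat.le_refl N)). cbv beta in HN.
    exists (INR N). intros T HT.
    destruct (INR_unbounded T) as [n Hn].
    pose proof (pos_INR N).
    pose proof (Hmono (INR N) T ltac:(lra) ltac:(lra)).
    pose proof (Hmono T (INR n) ltac:(lra) ltac:(lra)).
    specialize (Hle n). apply Rabs_lt_between in HN. apply Rabs_lt_between. lra.
Qed.

(** * The integral of u e^(-au) / cosh u *)

Definition sech_kernel (a u : R) : R := u * exp (- a * u) / cosh u.

Lemma cosh_pos u : 0 < cosh u.
Proof. unfold cosh. pose proof (exp_pos u). pose proof (exp_pos (- u)). lra. Qed.

Lemma continuous_sech_kernel a u : continuous (sech_kernel a) u.
Proof.
  apply (ex_derive_continuous (V := R_NormedModule)). unfold sech_kernel, cosh.
  auto_derive. pose proof (exp_pos u). pose proof (exp_pos (- u)). lra.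
Qed.

Lemma sech_kernel_pos a u : 0 <= u -> 0 <= sech_kernel a u.
Proof.
  intro Hu. apply Rdiv_le_0_compat; [|apply cosh_pos].
  apply Rmult_le_pos; [assumption|apply Rlt_le, exp_pos].
Qed.

(** Factoring out e^(-(a+1)u) leaves e^u + e^(-u), which cancels the cosh. *)
Lemma sech_kernel_add a u :
  sech_kernel a u + sech_kernel (a + 2) u = 2 * u * exp (- (a + 1) * u).
Proof.
  unfold sech_kernel. pose proof (cosh_pos u) as Hc.
  replace (- (a + 2) * u) with (- (a + 1) * u + - u) by ring.
  replace (- a * u) with (- (a + 1) * u + u) by ring.
  rewrite !exp_plus. unfold cosh in *. field. lra.
Qed.

Lemma is_RInt_exp b T : 0 < b ->
  is_RInt (fun u => 2 * u * exp (- b * u)) 0 T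
    (2 / b ^ 2 - 2 * exp (- b * T) * (T / b + / b ^ 2)).
Proof.
  intro Hb.
  set (F := fun u => - 2 * exp (- b * u) * (u / b + / b ^ 2)).
  replace (2 / b ^ 2 - 2 * exp (- b * T) * (T / b + / b ^ 2)) with (minus (F T) (F 0)).
  2:{ unfold F, minus, plus, opp; simpl. rewrite Rmult_0_r, exp_0. field; lra. }
  apply (is_RInt_derive (V := R_CompleteNormedModule)).
  - intros x _. unfold F. auto_derive; [lra|]. field; lra.
  - intros x _. apply (ex_derive_continuous (V := R_NormedModule)). auto_derive; trivial.
Qed.

Lemma is_RInt_gen_exp b : 0 < b ->
  is_RInt_gen (fun u => 2 * u * exp (- b * u)) (at_point 0) (Rbar_locally p_infty)
    (2 / b ^ 2).
Proof.
  intro Hb.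
  apply (is_RInt_gen_of_lim _ (fun T => 2 / b ^ 2 - 2 * exp (- b * T) * (T / b + / b ^ 2))).
  { intros T _; apply is_RInt_exp; assumption. }
  assert (Hm : is_lim (fun T => - b * T) p_infty m_infty).
  { replace m_infty with (Rbar_mult (- b) p_infty).
    - apply is_lim_scal_l, is_lim_id.
    - simpl. destruct (Rle_dec 0 (- b)) as [H|H]; [exfalso; lra|reflexivity]. }
  assert (H1 : is_lim (fun T => exp (- b * T)) p_infty 0).
  { apply (is_lim_comp exp (fun T => - b * T) p_infty 0 m_infty).
    - apply is_lim_exp_m.
    - assumption.
    - exists 0; intros y _; discriminate. }
  assert (H2 : is_lim (fun T => - b * T * exp (- b * T)) p_infty 0).
  { apply (is_lim_comp (fun y => y * exp y) (fun T => - b * T) p_infty 0 m_infty).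
    - apply is_lim_mul_exp_m.
    - assumption.
    - exists 0; intros y _; discriminate. }
  (* Written through y e^y and e^y at y = -bT, both of which tend to 0. *)
  apply is_lim_ext with
    (fun T => 2 / b ^ 2 + (2 / b ^ 2 * (- b * T * exp (- b * T)) + - 2 / b ^ 2 * exp (- b * T))).
  { intro T. field; lra. }
  replace (Finite (2 / b ^ 2)) with (Finite (2 / b ^ 2 + (2 / b ^ 2 * 0 + - 2 / b ^ 2 * 0)))
    by (f_equal; ring).
  apply is_lim_plus'; [apply is_lim_const|].
  apply is_lim_plus'; [apply (is_lim_scal_l _ _ _ 0 H2)|apply (is_lim_scal_l _ _ _ 0 H1)].
Qed.

(** Adding the nonnegative kernel for a+2 dominates the kernel by an exponential integrand with
    total 2/(a+1)^2. *)
Lemma sech_integral_exists a : 0 < a ->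
  exists l, 0 <= l /\ is_RInt_gen (sech_kernel a) (at_point 0) (Rbar_locally p_infty) l.
Proof.
  intro Ha. apply is_RInt_gen_bounded with (M := 2 / (a + 1) ^ 2).
  - apply continuous_sech_kernel.
  - apply sech_kernel_pos.
  - intros T HT.
    pose proof (is_RInt_exp (a + 1) T ltac:(lra)) as HI.
    apply Rle_trans with (RInt (fun u => 2 * u * exp (- (a + 1) * u)) 0 T).
    + apply RInt_le; [assumption| |eexists; exact HI|].
      * apply (ex_RInt_continuous (V := R_CompleteNormedModule)).
        intros; apply continuous_sech_kernel.
      * intros u Hu. rewrite <- sech_kernel_add.
        pose proof (sech_kernel_pos (a + 2) u). lra.
    + rewrite (is_RInt_unique _ _ _ _ HI).
      assert (0 <= 2 * exp (- (a + 1) * T) * (T / (a + 1) + / (a + 1) ^ 2)); [|lra].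
      pose proof (exp_pos (- (a + 1) * T)).
      assert (0 <= T / (a + 1)) by (apply Rdiv_le_0_compat; lra).
      assert (0 < / (a + 1) ^ 2) by (apply Rinv_0_lt_compat, pow_lt; lra).
      apply Rmult_le_pos; lra.
Qed.

Definition sech_integral (a : R) : R :=
  RInt_gen (sech_kernel a) (at_point 0) (Rbar_locally p_infty).

Lemma sech_integral_correct a : 0 < a -> 0 <= sech_integral a /\
  is_RInt_gen (sech_kernel a) (at_point 0) (Rbar_locally p_infty) (sech_integral a).
Proof.
  intro Ha. destruct (sech_integral_exists a Ha) as [l [Hl HI]].
  unfold sech_integral. rewrite (is_RInt_gen_unique _ _ HI). split; assumption.
Qed.

Lemma sech_integral_add a : 0 < a ->
  sech_integral a + sech_integral (a + 2) = 2 / (a + 1) ^ 2.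
Proof.
  intro Ha.
  destruct (sech_integral_correct a Ha) as [_ H1].
  destruct (sech_integral_correct (a + 2) ltac:(lra)) as [_ H2].
  assert (H : is_RInt_gen (fun u => 2 * u * exp (- (a + 1) * u)) (at_point 0)
                (Rbar_locally p_infty) (sech_integral a + sech_integral (a + 2))).
  { refine (is_RInt_gen_ext _ _ _ _ (is_RInt_gen_plus _ _ _ _ H1 H2)).
    apply filter_forall. intros ab u _. apply sech_kernel_add. }
  rewrite <- (is_RInt_gen_unique _ _ H).
  apply is_RInt_gen_unique, is_RInt_gen_exp. lra.
Qed.

(* Both sides are nonnegative solutions of h(a) + h(a+2r) = 2/(a+r)^2. *)
Lemma sech_integral_tk r a : 0 < r < a ->
  sech_integral (a / r) = r ^ 2 * / tk_full r a.
Proof.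
  intros [Hr Ha].
  set (f := fun b => 2 / (b + r) ^ 2).
  (* Rescaling turns the shift by 2 into a shift by 2r; the factor 1/r^2 adjusts the right side. *)
  set (h := fun b => / r ^ 2 * sech_integral (b / r)).
  set (k := fun b => / tk_full r b).
  assert (Hd : 0 < 2 * r) by lra.
  assert (Hh : forall b, r < b -> h b + h (b + 2 * r) = f b).
  { intros b Hb. unfold h, f. rewrite <- Rmult_plus_distr_l.
    replace ((b + 2 * r) / r) with (b / r + 2) by (field; lra).
    rewrite sech_integral_add by (apply Rdiv_lt_0_compat; lra). field; lra. }
  assert (Hk : forall b, r < b -> k b + k (b + 2 * r) = f b).
  { intros b Hb. apply tk_full_eq; lra. }
  assert (Hh0 : forall b, r < b -> 0 <= h b).
  { intros b Hb. apply Rmult_le_pos.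
    - apply Rlt_le, Rinv_0_lt_compat, pow_lt; lra.
    - apply sech_integral_correct, Rdiv_lt_0_compat; lra. }
  assert (Hk0 : forall b, r < b -> 0 <= k b).
  { intros b Hb. pose proof (tk_full_ge r b ltac:(lra)).
    apply Rlt_le, Rinv_0_lt_compat; nra. }
  (* Both solutions differ from the same partial sum by (-1)^n times a value in [0, f(b)], b = a +
     2rn, and (b+r)^2 >= r^2 (n+1). *)
  assert (Hbound : forall n, Rabs (h a - k a) <= 2 / r ^ 2 / INR (S n)).
  { intro n.
    pose proof (alt_sum_remainder f h _ _ Hd Hh n a Ha) as R1.
    pose proof (alt_sum_remainder f k _ _ Hd Hk n a Ha) as R2.
    replace (h a - k a) with ((h a - alt_sum f (2 * r) n a) - (k a - alt_sum f (2 * r) n a))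
      by ring.
    rewrite R1, R2, <- Rmult_minus_distr_l, Rabs_mult, pow_1_abs, Rmult_1_l.
    pose proof (pos_INR n) as Hn.
    set (b := a + INR n * (2 * r)) in *.
    assert (Hb : r < b) by (unfold b; nra).
    pose proof (Hh b Hb). pose proof (Hk b Hb).
    pose proof (Hh0 b Hb). pose proof (Hk0 b Hb).
    pose proof (Hh0 (b + 2 * r) ltac:(lra)). pose proof (Hk0 (b + 2 * r) ltac:(lra)).
    assert (Hf : f b <= 2 / r ^ 2 / INR (S n)).
    { unfold f. rewrite S_INR.
      replace (2 / r ^ 2 / (INR n + 1)) with (2 * / (r ^ 2 * (INR n + 1))) by (field; lra).
      apply Rmult_le_compat_l; [lra|]. apply Rinv_le_contravar.
      - apply Rmult_lt_0_compat; [apply pow_lt|]; lra.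
      - apply Rle_trans with ((r * (INR n + 1)) ^ 2); [|apply pow_incr; unfold b; nra].
        rewrite Rpow_mult_distr. apply Rmult_le_compat_l; [apply pow2_ge_0|nra]. }
    apply Rabs_le. lra. }
  assert (Heq : h a = k a).
  { apply Rminus_diag_uniq. apply Rabs_eq_0.
    apply Rle_antisym; [|apply Rabs_pos].
    exact (is_lim_seq_le _ _ (Rabs (h a - k a)) 0 Hbound
             (is_lim_seq_const _) (is_lim_seq_div_S _)). }
  unfold h, k in Heq. rewrite <- Heq. field; lra.
Qed.

(** * Agreement of the second derivative, the integral and the fractions *)

Theorem theorem12 (r s : R) (hr : 1 / 2 < r) (hs : Rmax 1 (2 * r - 1) < s) :
  (* the continued fractions involved converge *)
  (forall t : R, Rmax 1 (2 * r - 1) < t -> cf_converges (y_num r) (y_den t)) /\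
  cf_converges (tk_num (4 * r ^ 2)) (tk_den (cfc1 s r)) /\
  cf_converges (tk_num (4 * r ^ 2)) (tk_den (cfc2 s r)) /\
  (* ln y is differentiable in s on the region, and twice differentiable at s,
     with second derivative given by the improper integral and by -h1-h2 *)
  (forall t : R, Rmax 1 (2 * r - 1) < t -> ex_derive (fun u => ln (y_fun u r)) t) /\
  exists I : R,
    is_RInt_gen (integrand s r) (at_point 0) (Rbar_locally p_infty) I /\
    is_derive (Derive (fun u => ln (y_fun u r))) s (- (1 / (2 * r ^ 2)) * I) /\
    - (1 / (2 * r ^ 2)) * I = - h1 s r - h2 s r.
Proof.
  destruct (dom_gt r s hs) as [Hs1 Hs2].
  destruct (ln_y_derivatives r hr) as [Hd1 Hd2].
  assert (HA : 0 < 4 * r ^ 2) by nra.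
  split; [|split; [|split; [|split]]].
  - intros t Ht. destruct (dom_gt r t Ht). apply y_converges; lra.
  - apply tk_converges; [assumption|]. apply Rmult_lt_0_compat; lra.
  - apply tk_converges; [assumption|]. apply Rmult_lt_0_compat; lra.
  - exact Hd1.
  (* The integrand splits into two kernels, whose parameters are positive because s > max(1,
     2r-1). *)
  - set (I := sech_integral ((s + 1 - r) / r) + sech_integral ((s + r - 1) / r)).
    assert (HI : - (1 / (2 * r ^ 2)) * I = - (h1 s r + h2 s r)).
    (* Each integral is r^2 / X(a), and r^2 cancels against the prefactor 1/(2r^2). *)
    { unfold I. rewrite !sech_integral_tk, h_sum by lra.
      generalize (/ tk_full r (s + 1 - r)), (/ tk_full r (s + r - 1)).
      intros x y. field. lra. }
    exists I. split; [|split].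
    + destruct (sech_integral_correct ((s + 1 - r) / r)) as [_ H1];
        [apply Rdiv_lt_0_compat; lra|].
      destruct (sech_integral_correct ((s + r - 1) / r)) as [_ H2];
        [apply Rdiv_lt_0_compat; lra|].
      refine (is_RInt_gen_ext _ _ _ _ (is_RInt_gen_plus _ _ _ _ H1 H2)).
      apply filter_forall. intros ab u _. change plus with Rplus.
      unfold sech_kernel, integrand.
      replace (1 - r + s) with (s + 1 - r) by ring.
      replace (r - 1 + s) with (s + r - 1) by ring.
      pose proof (cosh_pos u). match goal with |- ?x = ?y => change (@eq R x y) end.
      field. lra.
    + rewrite HI. apply Hd2, hs.
    + rewrite HI. ring.
Qed.
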